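(* Let $\alpha$ be a fixed nonzero point of $L$ and let $c_1,c_2,c_3,\dots$ be complex numbers with $c_1\neq0$, and let $F$ be the function defined in the context. For integers $1\le a\le M$ and complex numbers $x_1,\dots,x_M$, \[ \sum_{s\in S(M,a)}\ \prod_{i=1}^a F\Big(\sum_{m\in s_i}x_m,\ |s_i|-1,\ 1\Big)=F\Big(\sum_{i=1}^M x_i,\ M-1,\ a\Big). \]
   Context: $L$ is the Riemann surface of the logarithm, parametrized by triples $(r,\theta,n)$ with $r>0$, $\theta\in(-\pi,\pi]$, $n\in\mathbb{Z}$; for $z=(r,\theta,n)\in L$ and $\gamma\in\mathbb{C}$, $z^\gamma=e^{\gamma\ln r+i\gamma\theta+2\pi i n\gamma}$. $S(M,a)$ is the set of set partitions $s=(s_1,\dots,s_a)$ of $\{1,\dots,M\}$ into $a$ nonempty pairwise disjoint blocks, ordered so that $\min s_i<\min s_j$ for $i<j$. For an integer $r\ge 0$, $C(r)$ is the set of sequences $\mu=(\mu_i)_{i\ge 1}$ of nonnegative integers, eventually zero, with $\sum_{i\ge1}\mu_i=r$. For $x\in\mathbb{C}$ and integer $n$, $\binom{x}{n}=\frac{x(x-1)\cdots(x-n+1)}{n!}$ for $n\ge 0$ and $\binom{x}{n}=0$ for $n<0$. For $x\in\mathbb{C}$ and integers $r\ge 0$, $a\ge 1$, \[ F(x,r,a)=\frac{-\alpha^{x}}{(a-1)!}\sum_{\mu\in C(r)}(-1)^{\mu_1}\binom{x}{\,r-\sum_{i\ge2}(i-1)\mu_i-(a-1)\,}\Big(r+\sum_{i\ge2}\mu_i\Big)!\,\frac{\alpha^{-(r-\sum_{i\ge2}(i-1)\mu_i-(a-1))}}{c_1^{\,r+1+\sum_{i\ge2}\mu_i}}\prod_{i\ge2}\frac{c_i^{\mu_i}}{\mu_i!},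 \] with powers of $\alpha$ taken in the sense of $L$. *)

(* Defs.v *)
From HB Require Import structures.
From mathcomp Require Import all_boot all_order all_algebra.
From mathcomp Require Import complex.
From mathcomp Require Import reals sequences exp trigo.
Set Implicit Arguments. Unset Strict Implicit. Unset Printing Implicit Defensive.
Import Order.TTheory GRing.Theory Num.Theory.
Local Open Scope ring_scope.
Local Open Scope complex_scope.

Definition Cexp (R : realType) (z : R[i]) : R[i] :=
  let: u +i* v := z in (expR u * cos v) +i* (expR u * sin v).

(* The Riemann surface of the logarithm: triples (r, theta, n) with r > 0,
   theta in (-pi, pi], n an integer. *)
Record Lpt (R : realType) := MkLpt {
  Lr : R; Lth : R; Ln : int;
  Lr_pos : 0 < Lr;
  Lth_range : (- pi < Lth) && (Lth <= pi) }.

Definition Lpow (R : realType) (z : Lpt R) (g : R[i]) : R[i] :=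
  Cexp (g * (ln (Lr z))%:C + 'i * g * (Lth z)%:C
        + (2 * pi)%:C * 'i * (Ln z)%:~R * g).

Definition gbinom (R : realType) (x : R[i]) (n : int) : R[i] :=
  match n with
  | Posz k => (\prod_(j < k) (x - j%:R)) / (k`!)%:R
  | Negz _ => 0
  end.

(* F(x, r, a).  The coefficients c_1, c_2, ... are c 1, c 2, ... (c 0 unused).
   A sequence mu in C(r) is represented by mu : {ffun 'I_r.+1 -> 'I_r.+1},
   mu j standing for mu_(j+1)..r+1 is harmless (all omitted terms vanish since the
   binomial has a negative lower index). *)
Definition Fsum (R : realType) (alpha : Lpt R) (c : nat -> R[i])
    (x : R[i]) (r a : nat) : R[i] :=
  \sum_(mu : {ffun 'I_r.+1 -> 'I_r.+1} | \sum_(j < r.+1) (mu j : nat) == r)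
    let s2 := \sum_(j < r.+1 | (0 < j)%N) (mu j : nat) in
    let N : int := (r%:Z - (\sum_(j < r.+1) ((j : nat) * mu j)%N)%:Z
                     - (a - 1)%:Z)%R in
    (-1) ^+ (mu ord0 : nat) * gbinom x N * ((r + s2)`!)%:R
    * Lpow alpha ((- N)%:~R) / (c 1%N) ^+ (r + 1 + s2)
    * \prod_(j < r.+1 | (0 < j)%N) (c (j.+1) ^+ (mu j : nat) / ((mu j : nat)`!)%:R).

Definition F (R : realType) (alpha : Lpt R) (c : nat -> R[i])
    (x : R[i]) (r a : nat) : R[i] :=
  - Lpow alpha x / (((a - 1)`!)%:R) * Fsum alpha c x r a.

Definition setmin (M : nat) (A : {set 'I_M}) : nat :=
  \big[minn/M]_(m in A) (m : nat).

(* S(M, a): s = (s_1, ..., s_a) with s_i = s (i-1), a set partition of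
   {1..M} (represented by 'I_M, element m standing for m+1) into a nonempty
   pairwise disjoint blocks ordered by increasing minima. *)
Definition is_setpart (M a : nat) (s : {ffun 'I_a -> {set 'I_M}}) : bool :=
  [&& [forall i, s i != set0],
      [forall i, forall j, (i != j) ==> [disjoint s i & s j]],
      (\bigcup_(i < a) s i == setT) &
      [forall i : 'I_a, forall j : 'I_a,
         ((i : nat) < j)%N ==> (setmin (s i) < setmin (s j))%N]].

(* Main.v *)
Require Import Defs.
From HB Require Import structures.
From mathcomp Require Import all_boot all_order all_algebra.
From mathcomp Require Import complex.
From mathcomp Require Import reals sequences exp trigo.
From mathcomp Require Import ring zify.
Set Implicit Arguments. Unset Strict Implicit. Unset Printing Implicit Defensive.
Import Order.TTheory GRing.Theory Num.Theory.
Local Open Scope ring_scope.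

(* F(x, r, a) is a Lagrange-inversion coefficient: expanding
   (c_1 + c_2 w + ...)^(-r-1) by the negative multinomial theorem gives
     F(x, r, a) = (-1)^(r+1) (r!/(a-1)!) [w^(r+1-a)] (alpha + w)^x (c_1 + c_2 w + ...)^(-r-1).
   With B_m = - (alpha + w)^(x_m) / (c_1 + c_2 w + ...), every F of the theorem is
     T_a(S) = ((|S|-1)!/(a-1)!) [w^(|S|-a)] prod_(m in S) B_m.
   Splitting off the block that contains the least element reduces the theorem to
     T_(a+1)(S) = sum_(e in A <= S) T_1(A) T_a(S \ A)   for a fixed e in S.
   This is multilinear in the B_m, so B_m = w^(k_m) may be assumed; then T_a(S) counts
   plane forests with a trees in which vertex m has k_m children, and the identity
   follows by induction, deleting a leaf. *)

(** * Counting plane forests with prescribed numbers of children *)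

Section Forests.
Variables (K : numFieldType) (I : finType).
Implicit Types (S A : {set I}) (k : I -> nat) (a n : nat).

(** Number of plane forests on [n] labelled vertices with [a] unordered trees, for fixed numbers of
    children adding up to [n - a]. The value 1 at [(0, 0)] is the empty forest. *)
Definition forest_weight a n : K :=
  match n, a with
  | 0, 0 => 1
  | n'.+1, a'.+1 => n'`!%:R / a'`!%:R
  | _, _ => 0
  end.

Lemma natr_fact_neq0 n : n`!%:R != 0 :> K.
Proof. by rewrite pnatr_eq0 -lt0n fact_gt0. Qed.

(** A new leaf is either an isolated root or fills one of [s] slots. For [a > 0] the common factor
    [(a+s-1)!/a!] leaves the splitting of [a + s]; the case [a = s = 0] rests on the value 1 at
    [(0, 0)]. *)
Lemma forest_weightS a s :
  forest_weight a.+1 (a + s)%N.+1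
  = forest_weight a (a + s)%N + s%:R * forest_weight a.+1 (a + s)%N.
Proof.
case: a => [|a]; rewrite ?add0n ?addSn /=.
  case: s => [|s] /=; first by rewrite mul0r addr0 divr1.
  by rewrite add0r factS natrM !divr1.
have h := natr_fact_neq0 a; have h' : a.+1%:R != 0 :> K by rewrite pnatr_eq0.
rewrite (factS a) (factS (a + s)) -addSn !natrM natrD.
rewrite invfM; move: h'; rewrite -natr1 => h'; by field; rewrite h' h.
Qed.

(** The indicator says that roots and children together account for every vertex. *)
Definition mono_count a S k : K :=
  forest_weight a #|S| * (a + \sum_(i in S) k i == #|S|)%N%:R.

Definition decr k p : I -> nat := fun i => if i == p then (k i).-1 else k i.

Lemma sum_decr_in S k p : p \in S -> (0 < k p)%N ->
  (\sum_(i in S) k i)%N = (\sum_(i in S) decr k p i)%N.+1.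
Proof.
move=> pS kp; rewrite (bigD1 p) //= [in RHS](bigD1 p) //= /decr eqxx.
rewrite -addSn prednK //; congr addn; apply: eq_bigr => i /andP[_ /negPf ip].
by rewrite ip.
Qed.

Lemma mono_count_decr_out a S k p : p \notin S ->
  mono_count a S (decr k p) = mono_count a S k.
Proof.
move=> pS; rewrite /mono_count; do 3!f_equal.
congr (_ == _); congr addn.
apply: eq_bigr => i iS; rewrite /decr; case: eqP => // ip.
by rewrite -ip iS in pS.
Qed.

Lemma mono_count0 S k : mono_count 0 S k = (S == set0)%:R.
Proof.
rewrite /mono_count; have [->|S0] := eqVneq S set0.
  by rewrite cards0 big_set0 /= mulr1.
by rewrite -cards_eq0 in S0; case: #|S| S0 => //= n _; rewrite mul0r.
Qed.

(** Deleting [m] removes one vertex and either one root or one filled slot, so all terms carry the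
    same indicator and [forest_weightS] adds the weights. *)
Lemma mono_count_leaf a S k m : m \notin S -> k m = 0%N ->
  mono_count a.+1 (m |: S) k
  = mono_count a S k + \sum_(p in S) (k p)%:R * mono_count a.+1 S (decr k p).
Proof.
move=> mS km; rewrite /mono_count cardsU1 mS add1n big_setU1 //= km add0n.
rewrite addSn eqSS.
rewrite (eq_bigr (fun p => (k p)%:R * (forest_weight a.+1 #|S|
   * (a + \sum_(i in S) k i == #|S|)%N%:R))); last first.
  (* At [k p = 0] the truncated predecessor in [decr] does not lower the sum, but the factor [k p]
     kills the term. *)
  move=> p pS; have [->|kp] := posnP (k p); first by rewrite !mul0r.
  by rewrite (sum_decr_in pS kp) addSn addnS.
rewrite -mulr_suml -natr_sum.
case: eqP => [<-|_]; last by rewrite !mulr0 addr0.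
by rewrite !mulr1 -forest_weightS.
Qed.

(** The complement of the tree of [e] may have to hold zero trees, so the leaf recursion must cover
    [a = 0], where every term vanishes. *)
Lemma mono_count_leaf_gen a S k m : m \notin S -> k m = 0%N ->
  mono_count a (m |: S) k
  = (if a is a'.+1 then mono_count a' S k else 0)
    + \sum_(p in S) (k p)%:R * mono_count a S (decr k p).
Proof.
case: a => [|a] mS km; last exact: mono_count_leaf.
rewrite add0r mono_count0 big1 => [|p pS]; last first.
  have /negPf S0 : S != set0 by apply/set0Pn; exists p.
  by rewrite mono_count0 S0 mulr0.
have /negPf -> // : m |: S != set0 by apply/set0Pn; exists m; rewrite setU11.
Qed.

Lemma big_subset_mem (m : I) (S : {set I}) (P : pred {set I}) (f : {set I} -> K) :
  m \in S ->
  \sum_(A : {set I} | [&& A \subset S, P A & m \in A]) f A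
  = \sum_(A : {set I} | (A \subset S :\ m) && P (m |: A)) f (m |: A).
Proof.
move=> mS.
rewrite (reindex_onto (fun A => m |: A) (fun A => A :\ m)) /=; last first.
  by move=> A /and3P[_ _ mA]; rewrite setD1K.
apply: eq_bigl => A; rewrite setU11 andbT subUset sub1set mS /= subsetD1.
have -> : ((m |: A) :\ m == A) = (m \notin A).
  apply/eqP/idP => [<-|]; last exact: setU1K.
  by rewrite !inE eqxx.
by rewrite andbAC.
Qed.

Lemma big_subset_notin (m : I) (S : {set I}) (P : pred {set I}) (f : {set I} -> K) :
  \sum_(A : {set I} | [&& A \subset S, P A & m \notin A]) f A
  = \sum_(A : {set I} | (A \subset S :\ m) && P A) f A.
Proof. by apply: eq_bigl => A; rewrite subsetD1 andbAC andbA. Qed.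

(** Without leaves the children alone are at least as many as the vertices, which leaves no room for
    a root. *)
Lemma mono_count_eq0 a S k :
  (forall m, m \in S -> (0 < k m)%N) -> mono_count a.+1 S k = 0.
Proof.
move=> kpos; rewrite /mono_count.
have le : (#|S| <= \sum_(i in S) k i)%N.
  by rewrite -sum1_card; apply: leq_sum => i /kpos.
by rewrite gtn_eqF ?mulr0 // addSn ltnS (leq_trans le) // leq_addl.
Qed.

(* A vertex with [k m = 0] is a leaf: it is an isolated root or hangs from one of
   the [k p] slots of some vertex [p]; deleting it drives the induction. *)
Lemma mono_count_convolution a S k e : e \in S ->
  \sum_(A : {set I} | (A \subset S) && (e \in A))
     mono_count 1 A k * mono_count a (S :\: A) k
  = mono_count a.+1 S k.
Proof.
have [n] := ubnP #|S|; elim: n a S k e => // n IH a S k e leSn eS.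
have [/existsP[m /andP[mS /eqP km]]|] := boolP [exists m in S, k m == 0%N]; last first.
  (* If [S] has no leaf, neither has any subset, and both sides vanish. *)
  move/exists_inPn => kpos.
  have kpos' m : m \in S -> (0 < k m)%N by rewrite lt0n; apply: kpos.
  rewrite mono_count_eq0 // big1 // => A /andP[/subsetP AS _].
  by rewrite (@mono_count_eq0 0 A) ?mul0r // => m /AS /kpos'.
have defS : m |: (S :\ m) = S by rewrite setD1K.
have ltSn : (#|S :\ m| < n)%N by rewrite (cardsD1 m) mS in leSn.
have mS' : m \notin S :\ m by rewrite !inE eqxx.
have UD A : A \subset S :\ m -> S :\: (m |: A) = (S :\ m) :\: A.
  by move=> _; rewrite setDDl.
rewrite -[in RHS]defS mono_count_leaf //.
(* The marked vertex [q] stays free: it is [p] when [e] is the deleted leaf, and [e] otherwise. *)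
have IHp p : p \in S :\ m -> forall q, q \in S :\ m ->
  \sum_(A : {set I} | (A \subset S :\ m) && (q \in A))
     mono_count 1 A (decr k p) * mono_count a ((S :\ m) :\: A) (decr k p)
  = mono_count a.+1 (S :\ m) (decr k p).
  by move=> _ q qS; apply: IH.
(* If [e] is the deleted leaf, its tree is [e] alone, which is the term [A = set0] after deletion,
   or [e] hangs from some [p], and then [p] marks the tree. *)
have [eqm|nem] := eqVneq e m.
  subst e.
  rewrite (eq_bigl (fun A : {set I} => [&& A \subset S, true & m \in A])) //.
  rewrite (big_subset_mem (fun=> true)) //=.
  rewrite (eq_bigr (fun A => mono_count 0 A k * mono_count a ((S :\ m) :\: A) k
    + \sum_(p in A) (k p)%:R * (mono_count 1 A (decr k p)
         * mono_count a ((S :\ m) :\: A) (decr k p)))); last first.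
    move=> A /andP[AS _]; rewrite UD // mono_count_leaf //; last first.
      by apply: contra mS'; apply: (subsetP AS).
    rewrite mulrDl mulr_suml; congr (_ + _); apply: eq_bigr => p pA.
    by rewrite -mulrA (@mono_count_decr_out a (_ :\: _)) // !inE pA.
  rewrite big_split /=; congr (_ + _).
    rewrite (bigD1 set0) ?sub0set //= mono_count0 eqxx mul1r setD0 big1 ?addr0 //.
    by move=> A /andP[_ /negPf A0]; rewrite mono_count0 A0 mul0r.
  rewrite (exchange_big_dep (mem (S :\ m))) /=; last first.
    by move=> A p /andP[/subsetP AS _]; apply: AS.
  apply: eq_bigr => p pS; rewrite -big_distrr /= -(IHp p pS p pS).
  by congr (_ * _); apply: eq_bigl => A; rewrite andbT.
(* Otherwise [m] lies in the tree of [e], where it cannot be an isolated root, or in the complement,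
   where it can be one or hang from a vertex. *)
have eS' : e \in S :\ m by rewrite !inE nem.
rewrite (bigID (fun A : {set I} => m \in A)) /=.
rewrite (eq_bigl (fun A : {set I} => [&& A \subset S, e \in A & m \in A])); last first.
  by move=> A; rewrite andbA.
rewrite (big_subset_mem (fun A => e \in A)) //.
rewrite [X in _ + X](eq_bigl (fun A : {set I} => [&& A \subset S, e \in A & m \notin A])); last first.
  by move=> A; rewrite andbA.
rewrite (big_subset_notin m S (fun A => e \in A)).
rewrite (eq_bigl (fun A : {set I} => (A \subset S :\ m) && (e \in A))); last first.
  by move=> A; rewrite !inE (negPf nem).
rewrite (eq_bigr (fun A : {set I} =>
    \sum_(p in A) (k p)%:R * (mono_count 1 A (decr k p)
         * mono_count a ((S :\ m) :\: A) (decr k p)))); last first.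
  move=> A /andP[AS eA]; rewrite UD // mono_count_leaf //; last first.
    by apply: contra mS'; apply: (subsetP AS).
  have /negPf A0 : A != set0 by apply/set0Pn; exists e.
  rewrite mono_count0 A0 add0r mulr_suml; apply: eq_bigr => p pA.
  by rewrite -mulrA (@mono_count_decr_out a (_ :\: _)) // !inE pA.
have DU A : A \subset S :\ m -> S :\: A = m |: ((S :\ m) :\: A).
  move=> /subsetP AS; apply/setP => i; rewrite !inE; have [->|] //= := eqVneq i m.
  by rewrite mS andbT; apply: contra mS'; apply: AS.
rewrite [X in _ + X](eq_bigr (fun A : {set I} =>
    mono_count 1 A k * (if a is a'.+1 then mono_count a' ((S :\ m) :\: A) k else 0)
    + \sum_(p in (S :\ m) :\: A) (k p)%:R * (mono_count 1 A (decr k p)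
         * mono_count a ((S :\ m) :\: A) (decr k p)))); last first.
  move=> A /andP[AS eA]; rewrite DU // mono_count_leaf_gen //; last first.
    by apply: contra mS'; rewrite inE => /andP[].
  rewrite mulrDr mulr_sumr; congr (_ + _); apply: eq_bigr => p.
  by rewrite inE => /andP[pA _]; rewrite (@mono_count_decr_out 1) // mulrCA.
(* The terms with [m] as an isolated root are the claim for one tree fewer; at [a = 0] both sides
   are zero. *)
rewrite [X in _ + X]big_split /= addrCA; congr (_ + _).
  case: a {IHp} => [|a]; last exact: IH.
  rewrite mono_count0; have /negPf -> : S :\ m != set0 by apply/set0Pn; exists e.
  by rewrite big1 // => A _; rewrite mulr0.
(* The parents [p] inside [A] and those outside together run over [S :\ m]. *)
rewrite -big_split /=.
under [RHS]eq_bigr => p pS do rewrite -(IHp p pS e eS') big_distrr /=.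
rewrite [RHS]exchange_big /=; apply: eq_bigr => A /andP[AS _].
rewrite [RHS](big_setID A) /=; congr (_ + _).
by apply: eq_bigl => p; rewrite (setIidPr AS).
Qed.
End Forests.

(** * Coefficients of products of polynomials, by multilinearity *)

Section LagrangeCoefficients.
Variables (K : numFieldType) (I : finType).
Implicit Types (S A : {set I}) (B : I -> {poly K}) (a : nat).

(** This is [T_a(S)]. The factor ['X^a] avoids the exponent [#|S| - a], so the coefficient is zero,
    not truncated, when [a] exceeds [#|S|]. *)
Definition poly_count a S B : K :=
  forest_weight K a #|S| * ('X^a * \prod_(i in S) B i)`_#|S|.

Lemma poly_count_monomial a S B (k : I -> nat) :
  (forall i, i \in S -> B i = 'X^(k i)) ->
  poly_count a S B = mono_count K a S k.
Proof.
move=> Bk; rewrite /poly_count /mono_count (eq_bigr (fun i => 'X^(k i))) //.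
by rewrite -expr_sum -exprD coefXn eq_sym.
Qed.

Lemma eq_poly_count a S B B' :
  (forall i, i \in S -> B i = B' i) -> poly_count a S B = poly_count a S B'.
Proof. by move=> BB; rewrite /poly_count (eq_bigr B'). Qed.

Definition upd B (m : I) (p : {poly K}) : I -> {poly K} :=
  fun i => if i == m then p else B i.

Lemma poly_count_upd_out a S B m p : m \notin S ->
  poly_count a S (upd B m p) = poly_count a S B.
Proof.
move=> mS; apply: eq_poly_count => i iS; rewrite /upd.
by case: eqP => // im; rewrite -im iS in mS.
Qed.

Lemma poly_count_updE a S B m p : m \in S ->
  poly_count a S (upd B m p)
  = forest_weight K a #|S| * (p * ('X^a * \prod_(i in S :\ m) B i))`_#|S|.
Proof.
move=> mS; rewrite /poly_count (big_setD1 m) //= {1}/upd eqxx mulrCA.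
congr (_ * (polyseq (_ * (_ * _)))`_ _); apply: eq_bigr => i; rewrite !inE /upd.
by case: eqP.
Qed.

Lemma poly_count_upd_sum a S B m p : m \in S ->
  poly_count a S (upd B m p)
  = \sum_(d < size p) p`_d * poly_count a S (upd B m 'X^d).
Proof.
move=> mS; rewrite poly_count_updE // -{1}(coefK p) poly_def mulr_suml coef_sum.
rewrite mulr_sumr; apply: eq_bigr => d _.
by rewrite poly_count_updE // -scalerAl coefZ mulrCA.
Qed.

(* Both sides are linear in each [B m], which reduces the claim to monomials. *)
Lemma poly_count_convolution a S B e : e \in S ->
  \sum_(A : {set I} | (A \subset S) && (e \in A))
     poly_count 1 A B * poly_count a (S :\: A) B
  = poly_count a.+1 S B.
Proof.
move=> eS.
(* The list [l] holds the indices whose polynomials may still be arbitrary; all others in [S] are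
   already powers of ['X]. Each induction step expands one polynomial. *)
suff H (l : seq I) B' :
    (forall i, i \in S -> i \notin l -> B' i = 'X^((size (B' i)).-1)) ->
  \sum_(A : {set I} | (A \subset S) && (e \in A))
     poly_count 1 A B' * poly_count a (S :\: A) B' = poly_count a.+1 S B'.
  by apply: (H (enum S)) => i iS; rewrite mem_enum iS.
elim: l B' => [|m l IH] B' HB.
  rewrite (@poly_count_monomial _ _ _ (fun i => (size (B' i)).-1)); last first.
    by move=> i iS; apply: HB.
  rewrite -(@mono_count_convolution _ _ _ _ _ e) //; apply: eq_bigr => A.
  move=> /andP[/subsetP AS _]; congr (_ * _); apply: poly_count_monomial => i.
    by move=> /AS iS; apply: HB.
  by rewrite inE => /andP[_ iS]; apply: HB.
have [mS|mS] := boolP (m \in S); last first.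
  apply: IH => i iS il; apply: HB => //; rewrite inE negb_or il andbT.
  by apply: contraNneq mS => <-.
have B'E a' A : poly_count a' A B' = poly_count a' A (upd B' m (B' m)).
  by apply: eq_poly_count => i _; rewrite /upd; case: eqP => // ->.
rewrite B'E poly_count_upd_sum //.
rewrite (eq_bigr (fun A : {set I} => \sum_(d < size (B' m)) (B' m)`_d *
    (poly_count 1 A (upd B' m 'X^d) * poly_count a (S :\: A) (upd B' m 'X^d)))).
  rewrite exchange_big /=; apply: eq_bigr => d _; rewrite -big_distrr /= IH //.
  move=> i iS il; rewrite /upd; case: eqP => [_|/eqP im]; first by rewrite size_polyXn.
  by apply: HB => //; rewrite inE negb_or im.
(* The index [m] lies in exactly one of [A] and [S :\: A], so only one factor is expanded. *)
move=> A _; rewrite !B'E; have [mA|mA] := boolP (m \in A).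
  have mA' : m \notin S :\: A by rewrite inE mA.
  rewrite poly_count_upd_sum // mulr_suml; apply: eq_bigr => d _.
  by rewrite !(poly_count_upd_out a _ _ mA') -mulrA.
have mA' : m \in S :\: A by rewrite inE mA.
rewrite [X in _ * X]poly_count_upd_sum // mulr_sumr; apply: eq_bigr => d _.
by rewrite !(poly_count_upd_out 1 _ _ mA) mulrCA.
Qed.
End LagrangeCoefficients.

(** * Ordered set partitions and removal of the first block *)

Section SetPartitions.
Variables (M : nat).
Implicit Types (A D : {set 'I_M}).

(** Relative to a subset [D], so that removing a block leaves a partition of the same kind;
    [D = setT] gives [is_setpart]. *)
Definition is_setpart_of D (a : nat) (s : {ffun 'I_a -> {set 'I_M}}) : bool :=
  [&& [forall i, s i != set0],
      [forall i, forall j, (i != j) ==> [disjoint s i & s j]],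
      (\bigcup_(i < a) s i == D) &
      [forall i : 'I_a, forall j : 'I_a,
         ((i : nat) < j)%N ==> (setmin (s i) < setmin (s j))%N]].

Lemma setmin_le A i : i \in A -> (setmin A <= i)%N.
Proof.
move=> iA; rewrite /setmin -minEnat -leEnat.
exact: bigmin_le_cond.
Qed.

Lemma setmin_mem A : A != set0 -> exists2 m, m \in A & setmin A = m.
Proof.
case/set0Pn=> i iA.
(* [M] is the default of the minimum; it exceeds every element and so is excluded once [A] is
   inhabited. *)
have : setmin A = M \/ exists2 m, m \in A & setmin A = m.
  rewrite /setmin; apply: (big_ind (fun x : nat => x = M \/ exists2 m, m \in A & x = m)).
  - by left.
  - by move=> x y Hx Hy; case: (leqP x y).
  - by move=> m mA; right; exists m.
case=> // AM; have := setmin_le iA.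
by rewrite AM leqNgt ltn_ord.
Qed.

Definition ffun_cons (a : nat) (A : {set 'I_M}) (s : {ffun 'I_a -> {set 'I_M}}) :
    {ffun 'I_a.+1 -> {set 'I_M}} :=
  [ffun i => if unlift ord0 i is Some j then s j else A].

Lemma ffun_cons0 a A (s : {ffun 'I_a -> {set 'I_M}}) : ffun_cons A s ord0 = A.
Proof. by rewrite ffunE unlift_none. Qed.

Lemma ffun_consS a A (s : {ffun 'I_a -> {set 'I_M}}) i :
  ffun_cons A s (lift ord0 i) = s i.
Proof. by rewrite ffunE liftK. Qed.

(** Minima increase, so the block containing the least element [e] must come first; conversely,
    blocks of [D :\: A] have minima above [e], so putting [A] in front keeps the order. *)
Lemma is_setpart_of_cons a D A (s : {ffun 'I_a -> {set 'I_M}}) e :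
  e \in D -> setmin D = e ->
  is_setpart_of D (ffun_cons A s)
  = [&& A \subset D, e \in A & is_setpart_of (D :\: A) s].
Proof.
move=> eD De.
have leD A' : A' != set0 -> A' \subset D -> (e <= setmin A')%N.
  move=> /setmin_mem[m mA ->] /subsetP AD; rewrite -De.
  by apply: setmin_le; apply: AD.
have mine A' : A' \subset D -> e \in A' -> setmin A' = e.
  move=> AD eA; apply/eqP; rewrite eqn_leq setmin_le //= leD //.
  by apply/set0Pn; exists e.
apply/idP/idP.
  case/and4P=> /forallP ne /forallP dis /eqP cov /forallP lt.
  have sub i : ffun_cons A s i \subset D by rewrite -cov; apply: bigcup_sup.
  have disA i : [disjoint s i & A].
    by have := forallP (dis (lift ord0 i)) ord0; rewrite ffun_consS ffun_cons0.
  have AD : A \subset D by have := sub ord0; rewrite ffun_cons0.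
  have A0 : A != set0 by have := ne ord0; rewrite ffun_cons0.
  have eA : e \in A.
    move: (eD); rewrite -cov => /bigcupP[i _ ei].
    case: (unliftP ord0 i) ei => [j|] -> ei; last by rewrite ffun_cons0 in ei.
    have := forallP (lt ord0) (lift ord0 j); rewrite /= ffun_cons0.
    by rewrite (mine _ (sub _) ei) ltnNge leD.
  rewrite AD eA /=; apply/and4P; split.
  - by apply/forallP=> i; have := ne (lift ord0 i); rewrite ffun_consS.
  - apply/forallP=> i; apply/forallP=> j; apply/implyP=> ij.
    have := forallP (dis (lift ord0 i)) (lift ord0 j); rewrite !ffun_consS.
    by move/implyP; apply; rewrite (inj_eq lift_inj).
  - rewrite -cov big_ord_recl ffun_cons0 setDUl setDv set0U.
    rewrite [X in _ == X :\: _](eq_bigr s) => [|i _]; last exact: ffun_consS.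
    rewrite eq_sym; apply/eqP/setDidPl.
    rewrite disjoint_sym disjoints_subset; apply/subsetP=> m mA.
    rewrite inE; apply/bigcupP => -[i _ mi].
    by have /disjointFl := disA i; move/(_ m mA); rewrite mi.
  - apply/forallP=> i; apply/forallP=> j; apply/implyP=> ij.
    have := forallP (lt (lift ord0 i)) (lift ord0 j); rewrite !ffun_consS.
    by move/implyP; apply.
case/and3P=> AD eA /and4P[/forallP ne /forallP dis /eqP cov /forallP lt].
have sub i : s i \subset D :\: A by rewrite -cov; apply: bigcup_sup.
have disA i : [disjoint s i & A].
  by apply: disjointWl (sub i) _; rewrite disjoints_subset setDE subsetIr.
apply/and4P; split.
- apply/forallP=> i; case: (unliftP ord0 i) => [j|] ->; first by rewrite ffun_consS.
  by rewrite ffun_cons0; apply/set0Pn; exists e.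
- apply/forallP=> i; apply/forallP=> j; apply/implyP.
  case: (unliftP ord0 i) => [i'|] ->; case: (unliftP ord0 j) => [j'|] ->;
    rewrite ?ffun_consS ?ffun_cons0 ?eqxx //.
  + by rewrite (inj_eq lift_inj) => ij; have := forallP (dis i') j'; rewrite ij.
  + by rewrite disjoint_sym.
- rewrite big_ord_recl ffun_cons0 (eq_bigr s) => [|i _]; last exact: ffun_consS.
  by rewrite cov -{1}(setIidPr AD) setID.
- apply/forallP=> i; apply/forallP=> j; apply/implyP.
  case: (unliftP ord0 i) => [i'|] ->; case: (unliftP ord0 j) => [j'|] ->;
    rewrite ?ffun_consS ?ffun_cons0 //=.
  + by move=> ij; have := forallP (lt i') j'; move/implyP; apply.
  + move=> _; rewrite (mine A) //; have /setmin_mem[m mj ->] := ne j'.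
    have /setDP[mD mA] := subsetP (sub j') m mj.
    rewrite ltn_neqAle -{2}De setmin_le // andbT.
    by apply: contraNneq mA => /val_inj <-.
Qed.

Lemma sum_setpart_of_rec (K : numFieldType) (h : {set 'I_M} -> K) a D e :
  e \in D -> setmin D = e ->
  \sum_(s : {ffun 'I_a.+1 -> {set 'I_M}} | is_setpart_of D s) \prod_(i < a.+1) h (s i)
  = \sum_(A : {set 'I_M} | (A \subset D) && (e \in A)) h A *
     \sum_(s : {ffun 'I_a -> {set 'I_M}} | is_setpart_of (D :\: A) s) \prod_(i < a) h (s i).
Proof.
move=> eD De.
under [RHS]eq_bigr => A _ do rewrite big_distrr /=.
rewrite pair_big_dep /=.
rewrite (reindex (fun q : {set 'I_M} * {ffun 'I_a -> {set 'I_M}} => ffun_cons q.1 q.2)) /=.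
  apply: eq_big => [[A s]|[A s] _] /=.
    by rewrite (is_setpart_of_cons _ _ eD De) andbA.
  rewrite big_ord_recl ffun_cons0; congr (_ * _).
  by apply: eq_bigr => i _; rewrite ffun_consS.
apply: onW_bij.
exists (fun s : {ffun 'I_a.+1 -> {set 'I_M}} => (s ord0, [ffun i => s (lift ord0 i)])).
  move=> [A s] /=; rewrite ffun_cons0; congr (_, _); apply/ffunP => i.
  by rewrite ffunE ffun_consS.
move=> s; apply/ffunP => i; case: (unliftP ord0 i) => [j|] -> /=.
  by rewrite ffun_consS ffunE.
by rewrite ffun_cons0.
Qed.

(** Removing the first block gives the recursion of [poly_count_convolution], with [e] the least
    element of [D]. Both sides start at [a = 0] with the indicator of [D = set0]. *)
Lemma sum_setpart_of_poly_count (K : numFieldType) (B : 'I_M -> {poly K}) a D :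
  \sum_(s : {ffun 'I_a -> {set 'I_M}} | is_setpart_of D s)
     \prod_(i < a) poly_count 1 (s i) B
  = poly_count a D B.
Proof.
elim: a D => [|a IH] D.
  have -> : poly_count 0 D B = (D == set0)%:R.
    rewrite /poly_count; have [->|D0] := eqVneq D set0.
      by rewrite cards0 big_set0 mulr1 expr0 coef1 mulr1.
    by rewrite -cards_eq0 in D0; case: #|D| D0 => //= n _; rewrite mul0r.
  have allE (s : {ffun 'I_0 -> {set 'I_M}}) : is_setpart_of D s = (D == set0).
    rewrite /is_setpart_of big_ord0 eq_sym.
    by apply/and4P/idP => [[]//|D0]; split=> //; apply/forallP; case.
  rewrite (eq_bigl (fun=> D == set0)) //; under eq_bigr do rewrite big_ord0.
  case: eqP => _; last by rewrite big_pred0.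
  by rewrite sumr_const card_ffun card_ord expn0.
have [->|/[dup] D0 /setmin_mem[e eD De]] := eqVneq D set0.
  rewrite /poly_count cards0 mul0r big1 // => s /and4P[/forallP ne _ /eqP cov _].
  have /set0Pn[m ms] := ne ord0.
  have : m \in \bigcup_(i < a.+1) s i by apply/bigcupP; exists ord0.
  by rewrite cov inE.
rewrite (sum_setpart_of_rec (fun A => poly_count 1 A B) _ eD De) -(poly_count_convolution _ _ eD).
by apply: eq_bigr => A _; rewrite IH.
Qed.
End SetPartitions.

(** * Polynomials modulo [X^n], standing for truncated power series *)

Section Truncation.
Variable K : comNzRingType.
Implicit Types (p q : {poly K}).

Definition eqmodX (n : nat) p q := forall i, (i < n)%N -> p`_i = q`_i.

Lemma eqmodX_sym n p q : eqmodX n p q -> eqmodX n q p.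
Proof. by move=> pq i /pq. Qed.

Lemma eqmodX_trans n p q r : eqmodX n p q -> eqmodX n q r -> eqmodX n p r.
Proof. by move=> pq qr i lin; rewrite pq ?qr. Qed.

Lemma eqmodXW m n p q : (m <= n)%N -> eqmodX n p q -> eqmodX m p q.
Proof. by move=> mn pq i im; apply: pq; apply: leq_trans mn. Qed.

Lemma eqmodXM n p p' q q' :
  eqmodX n p p' -> eqmodX n q q' -> eqmodX n (p * q) (p' * q').
Proof.
move=> pp qq i lin; rewrite !coefM; apply: eq_bigr => j _.
by rewrite pp ?qq //; apply: leq_ltn_trans lin; rewrite ?leq_subr -1?ltnS.
Qed.

Lemma eqmodXX n p q k : eqmodX n p q -> eqmodX n (p ^+ k) (q ^+ k).
Proof.
by move=> pq; elim: k => [|k IH] //; rewrite !exprS; apply: eqmodXM.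
Qed.

(** Serves to identify two truncated expansions of the same negative power. *)
Lemma eqmodX_inv_unique n p q q' :
  eqmodX n (p * q) 1 -> eqmodX n (p * q') 1 -> eqmodX n q q'.
Proof.
move=> pq pq'; apply: (@eqmodX_trans _ _ (q' * (p * q))).
  rewrite mulrCA mulrA -{1}(mul1r q); apply: eqmodXM => //.
  exact: eqmodX_sym.
by rewrite -{2}(mulr1 q'); apply: eqmodXM.
Qed.
End Truncation.

(** * The negative binomial expansion *)

Section NegativeBinomial.
Variables (K : numFieldType) (c1 : K) (u : {poly K}).
Hypotheses (c1n0 : c1 != 0) (u0 : u`_0 = 0).

(** Coefficient of [u^s] in [(c1 + u)^(-n)]. The predecessor is truncated at [n = s = 0], where the
    binomial is still 1. *)
Definition negbin_coef (n s : nat) : K :=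
  (-1) ^+ s * 'C((n + s).-1, s)%:R / c1 ^+ (n + s).

Definition negbin (n N : nat) : {poly K} :=
  \sum_(s < N.+1) negbin_coef n s *: u ^+ s.

Lemma negbin0 N : negbin 0 N = 1.
Proof.
rewrite /negbin big_ord_recl big1 => [|s _].
  by rewrite /negbin_coef /= bin0 !expr0 mulr1 divr1 scale1r addr0.
by rewrite /negbin_coef /= bin_small // mulr0 mul0r scale0r.
Qed.

(** Pascal's rule cancels all but one extra term, which is divisible by [X^(N+1)] because [u] has no
    constant term. *)
Lemma negbin_step n N :
  (c1%:P + u) * negbin n.+1 N
  = negbin n N + negbin_coef n.+1 N *: u ^+ N.+1.
Proof.
elim: N => [|N IH]; rewrite /negbin.
  rewrite !big_ord1 expr0 expr1 mulrDl -!scalerAr !mulr1; congr (_ + _).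
  rewrite -alg_polyC scalerA; congr (_ *: _).
  rewrite /negbin_coef !addn0 !bin0 exprS.
  by field; rewrite c1n0 expf_neq0.
rewrite big_ord_recr /= mulrDr -/(negbin _ _) IH.
rewrite [in RHS]big_ord_recr /= -/(negbin _ _) -!addrA; congr (_ + _).
rewrite mulrDl -!scalerAr mul_polyC -exprS scalerA addrA; congr (_ + _).
rewrite -scalerDl; congr (_ *: _).
rewrite /negbin_coef !addSn !addnS /= binS natrD !exprS.
by field; rewrite ?expf_neq0 ?c1n0.
Qed.

Lemma coef_exp_lt n i : (i < n)%N -> (u ^+ n)`_i = 0.
Proof.
elim: n i => // n IH i lin; rewrite exprS coefM big1 // => j _.
have [->|j0] := posnP j; first by rewrite u0 mul0r.
by rewrite IH ?mulr0 //; have := ltn_ord j; lia.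
Qed.

Lemma negbin_inv n N :
  eqmodX N.+1 ((c1%:P + u) ^+ n * negbin n N) 1.
Proof.
elim: n => [|n IH]; first by rewrite negbin0 mulr1.
apply: eqmodX_trans IH; rewrite exprSr -mulrA; apply: eqmodXM => // i lin.
by rewrite negbin_step coefD coefZ coef_exp_lt // mulr0 addr0.
Qed.
End NegativeBinomial.

(** * The multinomial theorem through exponential generating functions *)

Section Multinomial.
Variables (K : numFieldType).

(** In an outer variable [t], the product of the series [exp(t y_j)] is [exp(t sum_j y_j)];
    truncation at degree [r] does not affect coefficients up to [r]. *)
Lemma coef_prod_exp (J : finType) (P : pred J) (y : J -> {poly K}) (r s : nat) :
  (s <= r)%N ->
  (\prod_(j | P j) \poly_(d < r.+1) (d`!%:R^-1 *: y j ^+ d))`_s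
  = s`!%:R^-1 *: (\sum_(j | P j) y j) ^+ s.
Proof.
pose Q (p : {poly {poly K}}) (v : {poly K}) := forall t, (t <= r)%N ->
  p`_t = t`!%:R^-1 *: v ^+ t.
suff : Q (\prod_(j | P j) \poly_(d < r.+1) (d`!%:R^-1 *: y j ^+ d))
         (\sum_(j | P j) y j) by move=> H; apply: H.
apply: (big_rec2 Q) => [t _|j v p _ IH t tr].
  by rewrite coef1; case: t => [|t]; rewrite ?expr0 ?exprS ?mul0r ?scaler0 // invr1 scale1r.
rewrite coefM addrC exprDn scaler_sumr; apply: eq_bigr => d _.
have dt : (d <= t)%N by rewrite -ltnS.
rewrite coef_poly ltnS (leq_trans dt tr) IH; last by rewrite (leq_trans _ tr) ?leq_subr.
rewrite -scalerAl -scalerAr scalerA -scaler_nat scalerA [in RHS]mulrC; congr (_ *: _); last exact: mulrC.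
rewrite -(bin_fact dt) !natrM.
have h1 := natr_fact_neq0 K d; have h2 := natr_fact_neq0 K (t - d).
have h3 : 'C(t, d)%:R != 0 :> K by rewrite pnatr_eq0 -lt0n bin_gt0.
by field; rewrite h1 h2 h3.
Qed.

(** The total [r] ties [mu_1] to the sum [s] of the other entries, so the terms are grouped by
    [s = r - mu_1]. *)
Lemma sum_multinomial (r : nat) (f : nat -> K) (y : 'I_r.+1 -> {poly K}) :
  \sum_(mu : {ffun 'I_r.+1 -> 'I_r.+1} | (\sum_(j < r.+1) (mu j : nat))%N == r)
     f (mu ord0) *: \prod_(j < r.+1 | (0 < j)%N) ((mu j)`!%:R^-1 *: y j ^+ (mu j))
  = \sum_(s < r.+1) (f (r - s)%N / s`!%:R) *: (\sum_(j < r.+1 | (0 < j)%N) y j) ^+ s.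
Proof.
(* The index [ord0] carries the generating function of [f], the others truncated exponentials; the
   outer coefficient [r] imposes the total of [mu]. *)
pose G (j : 'I_r.+1) (d : nat) : {poly K} :=
  if j == ord0 then (f d)%:P else d`!%:R^-1 *: y j ^+ d.
have predE (j : 'I_r.+1) : (0 < j)%N = (j != ord0) by rewrite lt0n.
have : (\prod_(j < r.+1) \poly_(d < r.+1) G j d)`_r
     = \sum_(mu : {ffun 'I_r.+1 -> 'I_r.+1} | (\sum_(j < r.+1) (mu j : nat))%N == r)
         \prod_j G j (mu j).
  under eq_bigr do rewrite poly_def.
  rewrite bigA_distr_bigA coef_sum [RHS]big_mkcond; apply: eq_bigr => mu _ /=.
  rewrite scaler_prod -expr_sum coefZ coefXn eq_sym.
  by case: eqP; rewrite ?mulr1 ?mulr0.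
rewrite (bigD1 ord0) //= coefM => H.
transitivity (\sum_(mu : {ffun 'I_r.+1 -> 'I_r.+1} | (\sum_(j < r.+1) (mu j : nat))%N == r)
         \prod_j G j (mu j)).
  apply: eq_bigr => mu _; rewrite [RHS](bigD1 ord0) //= {1}/G eqxx mul_polyC.
  congr (_ *: _); apply: eq_big => [j|j]; first exact: predE.
  by rewrite predE /G => /negPf ->.
rewrite -H (reindex_inj rev_ord_inj) /=; apply: eq_bigr => s _.
have sr : (s <= r)%N by rewrite -ltnS.
rewrite subSS subKn // coef_poly ltnS leq_subr {1}/G eqxx mul_polyC -scalerA.
congr (_ *: _); rewrite -(coef_prod_exp _ _ sr); congr (polyseq _)`_ _.
apply: eq_big => [j|j]; rewrite ?predE // => /negPf j0.
by apply: eq_poly => d _; rewrite /G j0.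
Qed.
End Multinomial.

(** * Powers on the surface of the logarithm and the binomial series *)

Section PowersOnLog.
Variables (R : realType) (alpha : Lpt R).
#[local] Arguments gbinom : simpl never.

Lemma CexpD (z w : R[i]) : Cexp (z + w) = Cexp z * Cexp w.
Proof.
case: z w => [a b] [u v]; rewrite /Cexp /= expRD cosD sinD.
by congr (Complex _ _); ring.
Qed.

Lemma LpowD (x y : R[i]) : Lpow alpha (x + y) = Lpow alpha x * Lpow alpha y.
Proof. by rewrite /Lpow -CexpD; congr Cexp; ring. Qed.

Lemma Lpow0 : Lpow alpha 0 = 1.
Proof.
rewrite /Lpow !(mul0r, mulr0, addr0) /Cexp /= expR0 cos0 sin0.
by rewrite mulr1 mulr0.
Qed.

Lemma LpowN_nat (n : nat) : Lpow alpha (- (n%:R)) = Lpow alpha (-1) ^+ n.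
Proof.
elim: n => [|n IH]; first by rewrite oppr0 Lpow0.
by rewrite -natr1 opprD LpowD IH exprSr.
Qed.

Lemma gbinom0 (x : R[i]) : gbinom x 0%N = 1.
Proof. by rewrite /gbinom big_ord0 divr1. Qed.

Lemma gbinomS (x : R[i]) (n : nat) :
  n.+1%:R * gbinom x n.+1 = (x - n%:R) * gbinom x n.
Proof.
rewrite /gbinom big_ord_recr /= factS natrM invfM.
have h' : n.+1%:R != 0 :> R[i] by rewrite pnatr_eq0.
by rewrite mulrCA (mulVKf h') [X in X / _]mulrC mulrA.
Qed.

(** After multiplication by [n+1], splitting [n+1 = i + (n+1-i)] lets [gbinomS] act on either
    factor, and [(x-i) + (y-(n-i)) = x+y-n]. *)
Lemma gbinom_Vandermonde (x y : R[i]) (n : nat) :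
  gbinom (x + y) n = \sum_(i < n.+1) gbinom x i * gbinom y (n - i)%N.
Proof.
elim: n => [|n IH]; first by rewrite big_ord1 !gbinom0 mulr1.
have h : n.+1%:R != 0 :> R[i] by rewrite pnatr_eq0.
apply: (mulfI h); rewrite gbinomS IH !mulr_sumr.
pose g (i : nat) := gbinom x i * gbinom y (n.+1 - i)%N.
transitivity (\sum_(i < n.+2) i%:R * g i + \sum_(i < n.+2) (n.+1 - i)%N%:R * g i); last first.
  rewrite -big_split /=; apply: eq_bigr => i _.
  by rewrite -mulrDl -natrD subnKC // -ltnS.
rewrite [X in _ = X + _]big_ord_recl mul0r add0r.
rewrite [X in _ = _ + X]big_ord_recr /= subnn mul0r addr0.
rewrite -big_split /=; apply: eq_bigr => i _.
have lin : (i <= n)%N by rewrite -ltnS.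
rewrite /g /bump /= add1n subSS subSn //. 
rewrite [X in _ = X + _]mulrA gbinomS [X in _ = _ + X]mulrCA gbinomS.
by rewrite (natrB _ lin); ring.
Qed.

(** Truncated binomial series of [(alpha + w)^x] in [w]. *)
Definition pow_poly (N : nat) (x : R[i]) : {poly R[i]} :=
  \poly_(j < N) (Lpow alpha x * gbinom x j * Lpow alpha (-1) ^+ j).

Lemma pow_poly0 N : eqmodX N (pow_poly N 0) 1.
Proof.
move=> i iN; rewrite coef_poly iN coef1 Lpow0 mul1r.
case: i iN => [|i] _; first by rewrite gbinom0 mulr1.
by rewrite /gbinom big_ord_recl subrr !mul0r.
Qed.

(** The exponent law is Vandermonde's identity, coefficient by coefficient. *)
Lemma pow_polyD N x y :
  eqmodX N (pow_poly N x * pow_poly N y) (pow_poly N (x + y)).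
Proof.
move=> i iN; rewrite coefM coef_poly iN gbinom_Vandermonde LpowD.
rewrite mulr_sumr mulr_suml; apply: eq_bigr => j _.
have ji : (j <= i)%N by rewrite -ltnS.
rewrite !coef_poly (leq_ltn_trans ji iN) (leq_ltn_trans (leq_subr _ _) iN).
have -> : Lpow alpha (-1) ^+ i = Lpow alpha (-1) ^+ j * Lpow alpha (-1) ^+ (i - j).
  by rewrite -exprD subnKC.
by ring.
Qed.

Lemma pow_poly_sum N (I : finType) (A : {set I}) (x : I -> R[i]) :
  eqmodX N (\prod_(m in A) pow_poly N (x m)) (pow_poly N (\sum_(m in A) x m)).
Proof.
apply: (big_rec2 (fun p v => eqmodX N p (pow_poly N v))) => [|m v p _ IH].
  exact/eqmodX_sym/pow_poly0.
by apply: eqmodX_trans (@pow_polyD N _ _); apply: eqmodXM.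
Qed.
End PowersOnLog.

(** * [F] as a Lagrange coefficient *)

Section CoefficientFormula.
Variables (R : realType) (alpha : Lpt R) (c : nat -> R[i]).
Hypothesis c1n0 : c 1%N != 0.
#[local] Arguments gbinom : simpl never.

(** Truncation of [c_2 w + c_3 w^2 + ...], without the constant term [c_1]. *)
Definition tail_poly (N : nat) : {poly R[i]} :=
  \sum_(j < N | (0 < j)%N) c j.+1 *: 'X^j.

Lemma tail_poly_coef N i :
  (tail_poly N)`_i = if (0 < i < N)%N then c i.+1 else 0.
Proof.
rewrite coef_sum; case: ifP => [/andP[i0 iN]|iN].
  rewrite (bigD1 (Ordinal iN)) //= coefZ coefXn eqxx mulr1 big1 ?addr0 // => j.
  case/andP=> _ ji; rewrite coefZ coefXn; case: eqP => [ij|]; last by rewrite mulr0.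
  by case/eqP: ji; apply: val_inj.
rewrite big1 // => j j0; rewrite coefZ coefXn; case: eqP => [ij|]; last by rewrite mulr0.
by move: iN; rewrite ij j0 ltn_ord.
Qed.

Lemma tail_poly0 N : (tail_poly N)`_0 = 0.
Proof. by rewrite tail_poly_coef. Qed.

(** With [s = r - mu_1], the sign is [(-1)^r (-1)^s] and [(r+s)!/s!] is [r!] times a binomial, so
    the sum over [mu] becomes the expansion of [(c_1 + c_2 w + ...)^(-r-1)]. *)
Lemma Lpow_Fsum (x : R[i]) (N r a : nat) : (a <= r)%N -> (r < N)%N ->
  Lpow alpha x * Fsum alpha c x r a.+1
  = (-1) ^+ r * r`!%:R
    * (pow_poly alpha N x * negbin (c 1%N) (tail_poly r.+1) r.+1 r)`_(r - a).
Proof.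
move=> ar rN.
(* The part of a summand of [F] that depends on [mu_1 = d] alone, since the other entries add up to
   [r - d]. *)
pose f (d : nat) : R[i] :=
  (-1) ^+ d * (r + (r - d))`!%:R / c 1%N ^+ (r + 1 + (r - d)).
have -> : (-1) ^+ r * r`!%:R
    * (pow_poly alpha N x * negbin (c 1%N) (tail_poly r.+1) r.+1 r)`_(r - a)
  = (pow_poly alpha N x * \sum_(s < r.+1) (f (r - s)%N / s`!%:R) *: (tail_poly r.+1) ^+ s)`_(r - a).
  rewrite -coefZ scalerAr; congr (polyseq (_ * _))`_ _.
  rewrite /negbin scaler_sumr; apply: eq_bigr => s _; rewrite scalerA; congr (_ *: _).
  have sr : (s <= r)%N by rewrite -ltnS.
  rewrite /f /negbin_coef subKn // addSn /= addn1 addSn.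
  have -> : (-1) ^+ (r - s) = (-1) ^+ r * (-1) ^+ s :> R[i].
    by rewrite -signr_odd oddB // signr_addb !signr_odd.
  have := bin_fact (leq_addl r s); rewrite addnK => <-; rewrite !natrM.
  have h1 := natr_fact_neq0 R[i] s.
  by field; rewrite h1 expf_neq0.
rewrite /tail_poly -(sum_multinomial f (fun j : 'I_r.+1 => c j.+1 *: 'X^j)).
rewrite [in RHS]mulr_sumr coef_sum /Fsum mulr_sumr; apply: eq_bigr => mu /eqP mur.
set s2 := (\sum_(j < r.+1 | (0 < j)%N) (mu j : nat))%N.
set D := (\sum_(j < r.+1) ((j : nat) * mu j)%N)%N.
have s2E : s2 = (r - mu ord0)%N.
  have : (mu ord0 + s2)%N = r.
    rewrite -[RHS]mur [RHS](bigD1 ord0) //=; congr addn; apply: eq_bigl => j.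
    by rewrite lt0n.
  by lia.
have prodE : \prod_(j < r.+1 | (0 < j)%N) ((mu j)`!%:R^-1 *: (c j.+1 *: 'X^j) ^+ mu j)
  = (\prod_(j < r.+1 | (0 < j)%N) (c j.+1 ^+ mu j / (mu j)`!%:R)) *: 'X^D.
  under eq_bigr do rewrite exprZn scalerA -exprM [_^-1 * _]mulrC.
  rewrite scaler_prod; congr (_ *: _); rewrite -expr_sum; congr ('X^_).
  by rewrite /D [RHS](bigD1 ord0) //=; apply: eq_bigl => j; rewrite lt0n.
rewrite prodE scalerA -scalerAr coefZ coefMXn.
rewrite -/s2 -/D subn1 /=.
(* If [D > r - a], the coefficient of a multiple of ['X^D] vanishes, and so does the binomial, by
   its negative lower index. *)
have [lt|ge] := ltnP (r - a) D.
  suff -> : gbinom x (r%:Z - D%:Z - a%:Z) = 0 by rewrite !(mulr0, mul0r).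
  case E: (r%:Z - D%:Z - a%:Z)%R => [k|k] //; exfalso.
  by move: E lt; lia.
have -> : (r%:Z - D%:Z - a%:Z)%R = (r - a - D)%N :> int by lia.
rewrite coef_poly (leq_ltn_trans _ rN); last by rewrite -subnDA leq_subr.
rewrite mulrNz LpowN_nat /f -s2E.
by ring.
Qed.

(* The sign absorbs the factor [(-1) ^ #|A|] of [F]. *)
Definition block_poly (N : nat) (x : R[i]) : {poly R[i]} :=
  - (pow_poly alpha N x * negbin (c 1%N) (tail_poly N) 1 N).

(** Over a block, the powers of [alpha + w] multiply to the exponent [sum x_m] and the [#|A|]
    inverses to the power [-#|A|]. One truncation order [M] serves all blocks because
    [#|A| <= M]. *)
Lemma F_poly_count (M : nat) (x : 'I_M -> R[i]) (A : {set 'I_M}) (a : nat) :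
  (0 < a <= #|A|)%N ->
  F alpha c (\sum_(m in A) x m) (#|A| - 1)%N a
  = poly_count a A (fun m => block_poly M (x m)).
Proof.
case: a => // a /= aA.
case AE : #|A| aA => [|r] // ar; rewrite subn1 /=.
have rM : (r < M)%N by rewrite -AE -[M in (_ <= M)%N]card_ord max_card.
(* Both invert the same power modulo [X^(r+1)], which suffices since only the coefficient [r - a] is
   read. *)
have inv : eqmodX r.+1 (negbin (c 1%N) (tail_poly M) 1 M ^+ r.+1)
                       (negbin (c 1%N) (tail_poly r.+1) r.+1 r).
  have M0 n : (tail_poly n)`_0 = 0 := tail_poly0 n.
  apply: eqmodX_inv_unique; last exact: negbin_inv.
  apply: (@eqmodX_trans _ _ _ ((((c 1%N)%:P + tail_poly M) * negbin (c 1%N) (tail_poly M) 1 M) ^+ r.+1)).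
    rewrite exprMn; apply: eqmodXM => //; apply: eqmodXX => i ir.
    by rewrite !coefD !tail_poly_coef ir (leq_trans ir rM).
  rewrite -[X in eqmodX _ _ X](expr1n _ r.+1); apply: eqmodXX.
  rewrite -[X in X * _]expr1; apply: (@eqmodXW _ _ M.+1).
    exact: leqW.
  exact: negbin_inv.
rewrite /poly_count AE [LHS]/F subn1 /= coefXnM ltnS ltnNge -ltnS ar /= subSS.
rewrite prodrN big_split /= prodr_const AE.
have -> : (-1) ^+ r.+1 = ((-1) ^+ r.+1)%:P :> {poly R[i]} by rewrite polyC_exp polyCN.
rewrite coefCM.
rewrite (eqmodXM (eqmodXW rM (@pow_poly_sum R alpha M _ A x)) inv); last first.
  by rewrite ltnS leq_subr.
rewrite mulrAC [in LHS]mulNr (@Lpow_Fsum _ M) // exprS.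
by ring.
Qed.
End CoefficientFormula.

Theorem theorem3p3 (R : realType) (alpha : Lpt R) (c : nat -> R[i])
    (hc1 : c 1%N != 0) (M a : nat) (ha : (1 <= a)%N) (haM : (a <= M)%N)
    (x : 'I_M -> R[i]) :
  \sum_(s : {ffun 'I_a -> {set 'I_M}} | is_setpart s)
     \prod_(i < a) F alpha c (\sum_(m in s i) x m) (#|s i| - 1)%N 1%N
  = F alpha c (\sum_(m < M) x m) (M - 1)%N a.
Proof.
(* The same polynomials [block_poly] express every block factor on the left and, on the full set,
   the right side. *)
transitivity (poly_count a [set: 'I_M] (fun m => block_poly alpha c M (x m))).
  rewrite -sum_setpart_of_poly_count; apply: eq_bigr => s /and4P[/forallP ne _ _ _].
  by apply: eq_bigr => i _; rewrite F_poly_count // card_gt0 ne.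
rewrite -F_poly_count // cardsT card_ord ?ha //; congr F.
by apply: eq_bigl => m; rewrite inE.
Qed.
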